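(* Consider a bridge-edge dominating graph, i.e. a graph with $n$ nodes and $m$ edges in which all the edges are bridges, so that the probability that an edge $(a,b)$ is a bridge is $P_{ab}=1$ and the probability that it is a non-bridge edge is $1-P_{ab}=0$. The overall time of the Tracking-SHS algorithm to update the Top-$k$ structural hole spanners after deletion of an edge $(a,b)$, which in general is $T_{ab}=P_{ab}\left(\frac{5mn}{8}\right)+(1-P_{ab})(mn)$, then becomes $T_{ab}=\frac{5mn}{8}$. In contrast, the time required for static recomputation is $T'_{ab}=kn(m+n)$, i.e. $mn$, where $k$ is constant. Therefore the Tracking-SHS algorithm achieves an overall speedup of $\frac{T'_{ab}}{T_{ab}}=1.6$ times over recomputation. An example of such a graph is the Preferential Attachment graph.
   Context: Graphs $G=(V,E)$ are undirected and unweighted, without self-loops or multiple edges, with $n=|V|$ and $m=|E|$. The total pairwise connectivity is $P(G)=\sum_{i,j\in V\times V,\,i\neq j}u(i,j)$, where $u(i,j)=1$ if $i$ and $j$ are joined by a path and $0$ otherwise. The pairwise connectivity (PC) score of a node $i$ is $c(i)=P(G)-P(G\setminus\{i\})$. The structural hole spanner (SHS) problem asks for a set Top-$k$ of $k$ nodes whose removal minimizes the total pairwise connectivity of the residual graph. Static recomputation means running the following greedy algorithm from scratch: $k$ times, compute the PC score of every node of the current graph by depth-first search, add a node of maximum PC score to Top-$k$, and delete it from the graph. Its run time is $O(kn(m+n))$. The Tracking-SHS algorithm updates an old set Top-$k$ after the deletion of an edge $(a,b)$. It determines by depth-first search whether $(a,b)$ is a bridge (its deletion splits its connected component into two). It identifies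 the set $A$ of affected nodes (those reachable from $a$ or $b$), recomputes the PC scores of the affected nodes only, traversing for each node only its own connected component, and stores the scores in a max-priority queue. It then repeatedly takes the node $w$ of maximum PC score: it stops if that score is at most the minimum score in Top-$k$; otherwise, if $w$ is not in Top-$k$, it replaces the minimum-score node of Top-$k$ by $w$; in either case it removes $w$ from the graph and updates the queue. $P_{ab}$ denotes the probability that the deleted edge $(a,b)$ is a bridge. In the general formula for $T_{ab}$, $\frac{5mn}{8}$ is the time, in the expected case, for the deletion of a bridge edge, and $mn$ is the time for the deletion of a non-bridge edge. Standing assumptions of the analysis: the initial network has only one connected component (worst case), $k$ is taken to be $1$, and the time to update Top-$k$ is counted as the time to recompute the PC scores of the affected nodes (number of affected nodes times number of edges).
   Formalization: kn(m+n) never equals mn, so it is stated as a bound of order mn and the ratio 1.6 uses T' = mn (k = 1, nodes times edges); 5mn/8 is the assumed expected-case value, not proved for each graph; Preferential Attachment adds one edge per new node, from a single edge. *)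

(* Defs.v *)
From HB Require Import structures.
From mathcomp Require Import all_boot all_order all_algebra.

Set Implicit Arguments.
Unset Strict Implicit.
Unset Printing Implicit Defensive.

Import Order.TTheory GRing.Theory Num.Theory.

Section Graphs.
Variable T : finType.
Implicit Types (e : rel T) (A C E : {set T}) (v w : T) (s : seq T).

Definition simple_graph e : bool :=
  [forall x, ~~ e x x] && [forall x, forall y, e x y == e y x].

Definition connected_graph e : bool := [forall x, forall y, connect e x y].

Definition edges e : {set {set T}} :=
  [set E : {set T} | [exists x, exists y, e x y && (E == [set x; y])]].

Definition del_edge e E : rel T := [rel x y | e x y && ([set x; y] != E)].

Definition reach e A : {set T} := [set x | [exists y in A, connect e y x]].

(* [reach e E] is the connected component of the edge E in the graph e. *)
Definition bridge e E : bool :=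
  (E \in edges e) && (n_comp (del_edge e E) (reach e E) == 2).

Definition bridge_dominating e : bool := [forall E in edges e, bridge e E].

Definition restrict e A : rel T := [rel x y | [&& e x y, x \in A & y \in A]].

(* P(G[A]): the sum is over ordered pairs of distinct surviving nodes. *)
Definition total_pc e A : nat :=
  \sum_(i in A) \sum_(j in A | j != i) connect (restrict e A) i j.

(* The truncated subtraction is exact: deleting a node only disconnects. *)
Definition pc_score e A v : nat := total_pc e A - total_pc e (A :\ v).

(* [static_run e A s]: s lists, in order, the nodes picked by the greedy      *)
(* algorithm when it is run from scratch on the graph induced by e on A.      *)
Fixpoint static_run e A s : bool :=
  if s is v :: s' then
    [&& v \in A, [forall w in A, pc_score e A w <= pc_score e A v]
      & static_run e (A :\ v) s']
  else true.

(* Each round scores every surviving node by one depth-first search, which    *)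
(* costs the number of edges plus the number of nodes of the current graph.   *)
Fixpoint static_work e A s : nat :=
  if s is v :: s' then
    #|A| * (#|edges (restrict e A)| + #|A|) + static_work e (A :\ v) s'
  else 0.

Definition affected e E : {set T} := reach (del_edge e E) E.

Definition spanned e C : {set {set T}} := [set E in edges e | E \subset C].

(* Time Tracking-SHS spends after the deletion of E: every affected node is   *)
(* rescored by traversing its own component of the updated graph.  Edges are  *)
(* counted in the graph before the deletion, where m is measured, so that a   *)
(* traversal of the whole network costs m and not m - 1.                      *)
Definition tracking_time e E : nat :=
  \sum_(v in affected e E) #|spanned e (reach (del_edge e E) [set v])|.

(* T'_ab for k = 1 with the same count: static recomputation rescores every   *)
(* node, and each rescoring traverses the whole network.                      *)
Definition static_time e : nat := \sum_(v : T) #|spanned e [set: T]|.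

End Graphs.

Section Analysis.
Local Open Scope ring_scope.
Variables (R : realFieldType) (T : finType).
(* p E is the probability that E is the edge being deleted. *)
Implicit Types (e : rel T) (p : {set T} -> R).

Definition edge_distribution e p : Prop :=
  (forall E, E \in edges e -> 0 <= p E) /\ \sum_(E in edges e) p E = 1.

Definition prob_bridge e p : R := \sum_(E in edges e | bridge e E) p E.

Definition prob_nonbridge e p : R := \sum_(E in edges e | ~~ bridge e E) p E.

(* The mean tracking time restricted to bridges is the expected-case value    *)
(* 5mn/8; multiplying by P_ab avoids dividing by a possibly null P_ab.        *)
Definition expected_case e p : Prop :=
  \sum_(E in edges e | bridge e E) p E * (tracking_time e E)%:R
  = prob_bridge e p * (5 * #|edges e|%:R * #|T|%:R / 8).

Definition mean_tracking_time e p : R :=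
  \sum_(E in edges e) p E * (tracking_time e E)%:R.

(* T_ab *)
Definition overall_time e p : R :=
  prob_bridge e p * (5 * #|edges e|%:R * #|T|%:R / 8)
  + (1 - prob_bridge e p) * (#|edges e|%:R * #|T|%:R).

End Analysis.

(* Preferential attachment in which every arriving node brings one edge.  A   *)
(* state is a graph on the nodes 0, ..., n - 1, given by n and a relation on  *)
(* nat; the arriving node is n, and it picks its neighbour j with probability *)
(* deg(j) / (sum of all degrees).                                             *)
Definition degree n (g : rel nat) (j : nat) : nat := \sum_(i < n) g i j.

Definition attach n (g : rel nat) (j : nat) : rel nat :=
  [rel x y | [|| g x y, (x == n) && (y == j) | (x == j) && (y == n)]].

Definition seed_edge : rel nat :=
  [rel x y | ((x == 0) && (y == 1)) || ((x == 1) && (y == 0))].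

Definition on_ord n (g : rel nat) : rel 'I_n := [rel x y : 'I_n | g x y].
Arguments on_ord : clear implicits.

(* Probability that the graph satisfies Q after t further arrivals. *)
Fixpoint pa_prob (R : realFieldType) (Q : forall n, rel 'I_n -> bool)
    (t n : nat) (g : rel nat) : R :=
  if t is t'.+1 then
    (\sum_(j < n)
       (degree n g j)%:R / (\sum_(i < n) degree n g i)%:R
         * pa_prob R Q t' n.+1 (attach n g j))%R
  else ((Q n (on_ord n g))%:R)%R.

(* Main.v *)
Require Import Defs.
From mathcomp Require Import all_boot all_order all_algebra.
From mathcomp Require Import ring.

Import Order.TTheory GRing.Theory Num.Theory.
Local Open Scope ring_scope.

(** The mean tracking time splits over bridges and non-bridges. In a connected
graph, every vertex remains joined to [a] or [b] once [ab] is deleted, so [ab]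
is a bridge exactly when [a] and [b] are then separated; deleting a non-bridge
leaves the graph connected, every node is affected, and each rescoring
traverses the whole network. For preferential attachment, connectedness and
the bridge property are rephrased through cuts: an edge [ab] is a bridge when
some vertex set has [ab] as its only boundary edge. Cuts extend to an arriving
leaf by giving it the side of its neighbour. *)

(** * Bridges, affected nodes and edge counts in a connected graph *)

Section Graphs.
Variable T : finType.
Implicit Types (e : rel T) (A E : {set T}) (x y a b v w : T).

Lemma simple_graphP e :
  reflect ((forall x, e x x = false) /\ symmetric e) (simple_graph e).
Proof.
apply: (iffP andP) => [[/forallP irr /forallP sym]|[irr sym]]; split.
- by move=> x; apply/negbTE/irr.
- by move=> x y; apply/eqP/(forallP (sym x)).
- by apply/forallP => x; rewrite irr.
- by apply/forallP => x; apply/forallP => y; apply/eqP/sym.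
Qed.

Lemma connected_graphP e :
  reflect (forall x y, connect e x y) (connected_graph e).
Proof.
by apply: (iffP forallP) => H x; [move=> y; apply/(forallP (H x))|apply/forallP].
Qed.

Lemma edgesP e E :
  reflect (exists x y, e x y /\ E = [set x; y]) (E \in edges e).
Proof.
rewrite inE; apply: (iffP existsP) => [[x /existsP[y /andP[xy /eqP->]]]|].
  by exists x, y.
by move=> [x [y [xy ->]]]; exists x; apply/existsP; exists y; rewrite xy eqxx.
Qed.

Lemma del_edge_sym e E : symmetric e -> symmetric (del_edge e E).
Proof. by move=> se x y; rewrite /del_edge /= se setUC. Qed.

Lemma set2_eq (a b x y : T) : [set x; y] = [set a; b] ->
  (x = a /\ y = b) \/ (x = b /\ y = a).
Proof.
move=> Exy.
have : x \in [set a; b] by rewrite -Exy set21.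
have : y \in [set a; b] by rewrite -Exy set22.
have : a \in [set x; y] by rewrite Exy set21.
have : b \in [set x; y] by rewrite Exy set22.
by rewrite !inE; do 4![case/orP=> /eqP ?]; subst; auto.
Qed.

Lemma spanned_setT e : spanned e [set: T] = edges e.
Proof. by apply/setP => E; rewrite !inE subsetT andbT. Qed.

Lemma reach_connected e A x :
  connected_graph e -> x \in A -> reach e A = [set: T].
Proof.
move=> /connected_graphP ce xA; apply/setP => y; rewrite !inE.
by apply/existsP; exists x; rewrite xA ce.
Qed.

Lemma connect_cut e (P : pred T) x y :
  (forall u v, e u v -> P u = P v) -> connect e x y -> P x = P y.
Proof.
move=> clP /connectP[s es ->] {y}; elim: s x es => //= z s IH x /andP[xz es].
by rewrite (clP _ _ xz) IH.
Qed.

(** Beyond its last use of the edge [ab], a walk from [a] avoids that edge and starts at [a] or [b].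
    The induction extends the walk at its end: a last step along [ab] lands on [a] or [b] itself. *)
Lemma connect_del_edge e a b x : connect e a x ->
  connect (del_edge e [set a; b]) a x || connect (del_edge e [set a; b]) b x.
Proof.
case/connectP => s; elim/last_ind: s x => [|s z IH] x.
  by move=> _ ->; rewrite connect0.
rewrite rcons_path last_rcons => /andP[es ez] -> {x}.
have /(_ es erefl) := IH (last a s); set w := last a s in ez *.
have [Ewz _|nE] := eqVneq [set w; z] [set a; b].
  by case: (set2_eq _ _ _ _ Ewz) => -[_ ->]; rewrite connect0 ?orbT.
have wz : connect (del_edge e [set a; b]) w z.
  by apply: connect1; rewrite /del_edge /= ez nE.
by case/orP => /connect_trans/(_ wz) ->; rewrite ?orbT.
Qed.

Lemma bridgeE e a b : symmetric e -> connected_graph e -> e a b ->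
  bridge e [set a; b] = ~~ connect (del_edge e [set a; b]) a b.
Proof.
move=> se ce ab; rewrite /bridge (reach_connected _ _ _ ce (set21 a b)).
have -> : [set a; b] \in edges e by apply/edgesP; exists a, b.
set d := del_edge e _; have sd : connect_sym d.
  by apply: sym_connect_sym; apply: del_edge_sym.
suff -> : n_comp d [set: T] = #|[set fingraph.root d a; fingraph.root d b]|.
  by rewrite cards2 (root_connect sd); case: (connect d a b).
(* Components are counted by their roots, and each root of [d] is that of [a] or of [b]; the count
   is 2 exactly when these two differ. *)
apply: eq_card => x; rewrite !inE andbT; apply/eqP/orP => [rx|].
  have /connected_graphP/(_ a x)/(connect_del_edge _ _ b)/orP[] := ce;
    rewrite -(root_connect sd) rx => /eqP ->; by [left|right].
by case=> /eqP ->; apply/eqP; apply: roots_root.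
Qed.

Lemma del_nonbridge_connected e E : symmetric e -> connected_graph e ->
  E \in edges e -> ~~ bridge e E -> connected_graph (del_edge e E).
Proof.
move=> se ce /edgesP[a [b [ab ->]]]; rewrite bridgeE // negbK => dab.
set d := del_edge e _ in dab *.
have sd : connect_sym d by apply: sym_connect_sym; apply: del_edge_sym.
have da x : connect d a x.
  have /connected_graphP/(_ a x)/(connect_del_edge _ _ b)/orP[//|] := ce.
  exact: connect_trans.
by apply/connected_graphP => x y; apply: connect_trans (da y); rewrite sd.
Qed.

Lemma tracking_time_nonbridge e E : symmetric e -> connected_graph e ->
  E \in edges e -> ~~ bridge e E -> tracking_time e E = (#|edges e| * #|T|)%N.
Proof.
move=> se ce Ee nb; have cd := del_nonbridge_connected _ _ se ce Ee nb.
case/edgesP: (Ee) => a [b [_ EE]].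
rewrite /tracking_time /affected (reach_connected _ _ a cd) ?EE ?set21 // -EE.
rewrite (eq_bigr (fun=> #|edges e|)) => [|v _].
  by rewrite sum_nat_const cardsT mulnC.
by rewrite (reach_connected _ _ v cd) ?set11 // spanned_setT.
Qed.

Lemma static_timeE e : static_time e = (#|edges e| * #|T|)%N.
Proof.
rewrite /static_time (eq_bigr (fun=> #|edges e|)) => [|v _].
  by rewrite sum_nat_const mulnC.
by rewrite spanned_setT.
Qed.

Lemma edgesS e1 e2 : subrel e1 e2 -> edges e1 \subset edges e2.
Proof.
move=> s12; apply/subsetP => E /edgesP[x [y [/s12 xy ->]]].
by apply/edgesP; exists x, y.
Qed.

(** Each round runs on an induced subgraph, with at most as many nodes and edges as the whole
    graph. *)
Lemma static_work_le e A (s : seq T) :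
  (static_work e A s <= size s * #|T| * (#|edges e| + #|T|))%N.
Proof.
elim: s A => //= v s IH A; rewrite -mulnA mulSn mulnA leq_add //.
rewrite leq_mul ?max_card // leq_add ?max_card // subset_leq_card //.
by apply: edgesS => x y /and3P[].
Qed.

(** No vertex is isolated, so the edges cover the vertex set, and each covers at most two vertices.
    This lets the term [n * n] of the static cost be absorbed into [m * n]. *)
Lemma connected_order_le e : simple_graph e -> connected_graph e ->
  edges e != set0 -> (#|T| <= 2 * #|edges e|)%N.
Proof.
move=> /simple_graphP[irr se] /connected_graphP ce /set0Pn[_ /edgesP[a [b [ab _]]]].
have covT : cover (edges e) = [set: T].
  apply/setP => x; rewrite inE; apply/bigcupP.
  have [z xz] : exists z, e x z.
    (* A path to any other vertex starts with an edge at [x]; one of [a] and [b] is such a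
       vertex. *)
    have [y nxy] : exists y, x != y.
      have [xa|?] := eqVneq x a; last by exists a.
      by exists b; apply: contraTneq ab => xb; rewrite -xa -xb irr.
    have /connectP[[|z s] /=] := ce x y.
      by move=> _ /eqP; rewrite eq_sym (negbTE nxy).
    by move=> /andP[xz _] _; exists z.
  by exists [set x; z]; [apply/edgesP; exists x, z|rewrite set21].
rewrite -cardsT -covT; apply: leq_trans (leq_card_cover _).1 _.
rewrite mulnC -sum_nat_const; apply: leq_sum => E /edgesP[x [y [_ ->]]].
by rewrite cards2; case: (x != y).
Qed.

End Graphs.

(** * Probabilities and mean tracking time *)

Section Analysis.
Variables (R : realFieldType) (T : finType) (e : rel T) (p : {set T} -> R).

Lemma prob_nonbridgeE : edge_distribution e p ->
  prob_nonbridge e p = 1 - prob_bridge e p.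
Proof.
by case=> _; rewrite (bigID (bridge e)) /= => <-; rewrite addrAC subrr add0r.
Qed.

Lemma mean_tracking_timeE : symmetric e -> connected_graph e ->
  edge_distribution e p -> expected_case e p ->
  mean_tracking_time e p = overall_time e p.
Proof.
move=> se ce dp ec; rewrite /mean_tracking_time (bigID (bridge e)) /= ec.
rewrite /overall_time -prob_nonbridgeE // /prob_nonbridge.
congr (_ + _); rewrite mulr_suml; apply: eq_bigr => E /andP[Ee nb].
by rewrite tracking_time_nonbridge // natrM.
Qed.

Lemma edge_distribution_neq0 : edge_distribution e p -> edges e != set0.
Proof.
case=> _ s1; apply/eqP => e0; move: s1.
by rewrite e0 big_set0 => /esym/eqP; rewrite oner_eq0.
Qed.

Lemma prob_bridge_dominating : bridge_dominating e -> edge_distribution e p ->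
  prob_bridge e p = 1.
Proof.
move=> /forall_inP be [_ <-]; apply: eq_bigl => E.
by apply: andb_idr => /be.
Qed.

End Analysis.

Lemma edges_order_gt0 (T : finType) (e : rel T) :
  edges e != set0 -> (0 < #|edges e| /\ 0 < #|T|)%N.
Proof.
move=> e0; rewrite card_gt0; split=> //.
by case/set0Pn: e0 => _ /edgesP[a _]; apply/card_gt0P; exists a.
Qed.

(** * Preferential attachment yields trees *)

(* [pa_tree n g]: [g] is a tree on the nodes 0, ..., n - 1, with connectedness *)
(* and acyclicity expressed through cuts, i.e. boolean vertex labellings.      *)
Definition pa_tree (n : nat) (g : rel nat) : Prop :=
  [/\ (1 < n)%N,
      forall x y, g x y -> [/\ (x < n)%N, (y < n)%N & x != y],
      symmetric g,
      forall P : pred nat, (forall x y, g x y -> P x = P y) ->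
        forall x y, (x < n)%N -> (y < n)%N -> P x = P y
    & forall a b, g a b -> exists P : pred nat, P a != P b /\
        forall x y, g x y -> P x != P y ->
          (x = a /\ y = b) \/ (x = b /\ y = a)].

Lemma pa_tree_seed : pa_tree 2 seed_edge.
Proof.
split=> //.
- by move=> x y /orP[]/andP[/eqP-> /eqP->].
- by move=> x y; rewrite /seed_edge /= orbC; congr (_ || _); rewrite andbC.
- move=> P clP; have P01 : P 0%N = P 1%N by apply: clP.
  by move=> [|[|?]] [|[|?]].
- move=> a b ab; exists (pred1 a); split.
    by case/orP: ab => /andP[/eqP-> /eqP->].
  by move=> x y; case/orP: ab => /andP[/eqP-> /eqP->];
    case/orP => /andP[/eqP-> /eqP->]; auto.
Qed.

Lemma pa_tree_attach n g j : (j < n)%N -> pa_tree n g ->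
  pa_tree n.+1 (attach n g j).
Proof.
move=> jn [n1 gn sg cg bg].
have gltn x : g x n = false by apply/negP => /gn[]; rewrite ltnn.
have gltn' x : g n x = false by rewrite sg.
have jNn : (j == n) = false by rewrite ltn_eqF.
split.
- exact: ltnW.
- move=> x y /or3P[/gn[xn yn ->]|/andP[/eqP-> /eqP->]|/andP[/eqP-> /eqP->]].
  + by split=> //; apply: leqW.
  + by rewrite eq_sym jNn; split=> //; apply: leqW.
  + by rewrite jNn; split=> //; apply: leqW.
- move=> x y; rewrite /attach /= sg; congr (_ || _); rewrite orbC.
  by congr (_ || _); rewrite andbC.
- move=> P clP; have Pn : P n = P j by apply: clP; rewrite /attach /= !eqxx orbT.
  have Po x y : (x < n)%N -> (y < n)%N -> P x = P y.
    by apply: cg => u v uv; apply: clP; rewrite /attach /= uv.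
  have Pj x : (x < n.+1)%N -> P x = P j.
    by rewrite ltnS leq_eqVlt => /predU1P[->//|xn]; apply: Po.
  by move=> x y xn yn; rewrite !Pj.
(* The cut isolating [n] is crossed by the new edge only, since [g] has no edge at [n]. *)
- have leaf : exists P : pred nat, P n != P j /\ forall x y, attach n g j x y ->
      P x != P y -> (x = n /\ y = j) \/ (x = j /\ y = n).
    exists (pred1 n); split; first by rewrite /= eqxx jNn.
    move=> x y /or3P[xy|/andP[/eqP-> /eqP->]|/andP[/eqP-> /eqP->]]; auto.
    by have [xn yn _] := gn _ _ xy; rewrite /= !ltn_eqF.
  move=> a b /or3P[ab|/andP[/eqP-> /eqP->]|/andP[/eqP-> /eqP->]] //; last first.
    have [P [PN HP]] := leaf; exists P; split; first by rewrite eq_sym.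
    by move=> x y xy /HP-/(_ xy)[]; auto.
  have [P [Pab HP]] := bg _ _ ab.
  (* With [n] on the side of [j], the new edge does not cross the old cut. *)
  exists (fun x => if x == n then P j else P x).
  have [an bn _] := gn _ _ ab; rewrite !ltn_eqF //; split=> // x y.
  move=> /or3P[xy|/andP[/eqP-> /eqP->]|/andP[/eqP-> /eqP->]].
  + by have [xn yn _] := gn _ _ xy; rewrite !ltn_eqF //; apply: HP.
  + by rewrite eqxx jNn eqxx.
  + by rewrite eqxx jNn eqxx.
Qed.

Lemma pa_tree_bridge_dominating n g : pa_tree n g ->
  [&& simple_graph (on_ord n g), connected_graph (on_ord n g)
    & bridge_dominating (on_ord n g)].
Proof.
move=> [n1 gn sg cg bg]; set e := on_ord n g.
have se : symmetric e by move=> x y; apply: sg.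
have ce : connected_graph e.
  apply/connected_graphP => x y.
  (* The labelling is the component of [x], extended by [false] to naturals that are not nodes. *)
  pose P k := if insub k is Some z then connect e x z else false.
  have PE (z : 'I_n) : P z = connect e x z by rewrite /P valK.
  suff : P x = P y by rewrite !PE connect0 => <-.
  apply: cg => // u v uv; have [un vn _] := gn _ _ uv.
  rewrite -[u]/(val (Ordinal un)) -[v]/(val (Ordinal vn)) !PE.
  by apply: same_connect1r => //; apply: sym_connect_sym.
apply/and3P; split=> //.
  by apply/simple_graphP; split=> // x; apply/negP => /gn[_ _]; rewrite eqxx.
apply/forall_inP => E /edgesP[a [b [ab ->]]]; rewrite bridgeE //.
have [P [Pab HP]] := bg _ _ ab.
apply: contra Pab => dab; apply/eqP.
(* Once [ab] is deleted no edge crosses the cut [P], so a path from [a] to [b] would force equal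
   labels. *)
apply: (connect_cut _ _ (fun z : 'I_n => P z) _ _ _ dab) => u v /andP[uv nE].
apply/eqP; apply: contraNT nE => /(HP _ _ uv).
by case=> -[/val_inj-> /val_inj->] //; rewrite setUC.
Qed.

(** This makes the attachment weights well normalised. If all degrees vanished there would be no
    edges, and the label singling out node 0 would separate it from node 1 without cutting any
    edge. *)
Lemma pa_tree_degree_gt0 n g : pa_tree n g ->
  (0 < \sum_(i < n) degree n g i)%N.
Proof.
move=> [n1 gn sg cg _]; rewrite lt0n; apply/eqP => /eqP.
rewrite sum_nat_eq0 => /forallP d0.
have g0 x y : g x y = false.
  apply/negP => xy; have [xn yn _] := gn _ _ xy.
  have := d0 (Ordinal xn); rewrite /degree sum_nat_eq0 => /forallP.
  by move=> /(_ (Ordinal yn)); rewrite /= sg xy.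
have := cg (pred1 0%N) _ 0%N 1%N (ltnW n1) n1; rewrite /=.
by move=> /(_ (fun x y => ltac:(by rewrite g0))).
Qed.

Lemma pa_tree_prob (R : realFieldType) t n g : pa_tree n g ->
  pa_prob R
    (fun n (e : rel 'I_n) =>
       [&& simple_graph e, connected_graph e & bridge_dominating e]) t n g = 1.
Proof.
elim: t n g => [|t IH] n g tg /=; first by rewrite pa_tree_bridge_dominating.
rewrite (eq_bigr (fun j : 'I_n =>
  (degree n g j)%:R / (\sum_(i < n) degree n g i)%:R)) => [|j _].
  rewrite -mulr_suml -natr_sum divff // pnatr_eq0 -lt0n.
  exact: pa_tree_degree_gt0.
by rewrite IH ?mulr1 //; apply: pa_tree_attach.
Qed.

Theorem mainTheorem2 (R : realFieldType) :
  (* for constant k, k n (m + n) is of the order of m n *)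
  (forall k : nat, (0 < k)%N ->
     exists c C : R, [/\ 0 < c, 0 < C
       & forall (T : finType) (e : rel T),
           simple_graph e -> connected_graph e -> edges e != set0 ->
           c * (#|edges e| * #|T|)%N%:R
             <= (k * #|T| * (#|edges e| + #|T|))%N%:R
             <= C * (#|edges e| * #|T|)%N%:R])
  /\
  (forall (T : finType) (e : rel T) (p : {set T} -> R),
     simple_graph e -> connected_graph e -> edge_distribution e p ->
     (* the general formula for T_ab *)
     [/\ prob_nonbridge e p = 1 - prob_bridge e p,
         forall E, E \in edges e -> ~~ bridge e E ->
           tracking_time e E = (#|edges e| * #|T|)%N
       & expected_case e p -> mean_tracking_time e p = overall_time e p]
     /\
     (* static recomputation on the updated graph *)
     (forall (E : {set T}) (s : seq T), E \in edges e ->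
        static_run (del_edge e E) [set: T] s ->
        (static_work (del_edge e E) [set: T] s
           <= size s * #|T| * (#|edges e| + #|T|))%N)
     /\
     (* bridge-edge dominating graphs *)
     (bridge_dominating e ->
      [/\ prob_bridge e p = 1,
          prob_nonbridge e p = 0,
          overall_time e p = 5 * #|edges e|%:R * #|T|%:R / 8,
          static_time e = (#|edges e| * #|T|)%N
        & (static_time e)%:R / overall_time e p = 16 / 10]))
  /\
  (* preferential attachment graphs are almost surely of this kind *)
  (forall t : nat,
     pa_prob R
       (fun n (e : rel 'I_n) =>
          [&& simple_graph e, connected_graph e & bridge_dominating e])
       t 2 seed_edge = 1).
Proof.
split; [|split; last by move=> t; apply/pa_tree_prob/pa_tree_seed].
  (* The factor 3 comes from [n <= 2 * m], which gives [m + n <= 3 * m]. *)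
  move=> k k0; exists 1, (3 * k)%N%:R; split; rewrite ?ltr01 ?ltr0n ?muln_gt0 //.
  move=> T e sge ce e0; rewrite mul1r -natrM !ler_nat.
  apply/andP; split.
    rewrite -mulnA; apply: leq_trans (leq_pmull _ k0).
    by rewrite mulnC leq_mul2l leq_addr orbT.
  have := connected_order_le _ _ sge ce e0; set m := #|edges e|; set n := #|T|.
  move=> nm; have h : (n * (m + n) <= 3 * (m * n))%N.
    by rewrite mulnA [leqRHS]mulnC leq_mul2l mulSn leq_add2l nm orbT.
  by rewrite -mulnA [(3 * k)%N]mulnC -[leqRHS]mulnA leq_mul2l h orbT.
move=> T e p sge ce dp; have [_ se] := simple_graphP _ _ sge.
split; [|split].
- split; first exact: prob_nonbridgeE.
    by move=> E; apply: tracking_time_nonbridge.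
  exact: mean_tracking_timeE.
- move=> E s _ _; apply: leq_trans (static_work_le _ _ _ _) _.
  rewrite leq_mul2l leq_add2r subset_leq_card ?orbT //.
  by apply: edgesS => x y /andP[].
- move=> be; have pb := prob_bridge_dominating _ _ _ _ be dp.
  have oT : overall_time e p = 5 * #|edges e|%:R * #|T|%:R / 8.
    by rewrite /overall_time pb subrr mul0r addr0 mul1r.
  split=> //; first by rewrite prob_nonbridgeE // pb subrr.
    exact: static_timeE.
  rewrite oT static_timeE natrM.
  (* Total probability 1 forces an edge to exist, so [m] and [n] can be cancelled in the ratio. *)
  have [m0 n0] := edges_order_gt0 _ _ (edge_distribution_neq0 _ _ _ _ dp).
  have : #|edges e|%:R != 0 :> R by rewrite pnatr_eq0 -lt0n.
  have : #|T|%:R != 0 :> R by rewrite pnatr_eq0 -lt0n.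
  by move=> hn hm; field; rewrite hn hm.
Qed.
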